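(* Let $m$ be a positive integer and let $a_1, \ldots, a_t$ be integers with $a_1 + \cdots + a_t = m(m+1)/2$ and $a_i \ge \min\{1600 i, 20(m+1)\}$ for every $i \in [t]$. Then the set $[m] = \{1, \ldots, m\}$ can be partitioned into sets $A_1, \ldots, A_t$ such that $\sum_{x \in A_i} x = a_i$ for every $i \in [t]$. *)

(* Defs.v *)
From mathcomp Require Import all_boot all_order all_algebra.

Set Implicit Arguments.
Unset Strict Implicit.
Unset Printing Implicit Defensive.

(* [m] = {1, ..., m}, with elements read through the coercion 'I_m.+1 >-> nat;
   the ordinal 0 is left out. *)
Definition one_to (m : nat) : {set 'I_m.+1} := [set x : 'I_m.+1 | 0 < x].

(* The blocks are indexed: since [partition] only sees the set of blocks (and
   requires them to be non-empty), injectivity is what makes the blocks with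
   distinct indices disjoint. *)
Definition partitioned_into (T : finType) (t : nat) (A : 'I_t -> {set T})
    (D : {set T}) : Prop :=
  injective A /\ partition [set A i | i : 'I_t] D.

(* Main.v *)
(* Put n = m + 1 and group [m] into the pairs {x, n - x}, each of sum n.
   Serve the targets one at a time.  A target picks two elements y, z from
   untouched pairs with y + z congruent modulo n to what it still needs; it can
   then be completed by untouched pairs, and the partners n - y, n - z are left
   as orphans to be absorbed by later targets.  The targets below 20n come
   first, in index order, so that a_i >= 1600 i leaves enough admissible choices
   of y, and they absorb nothing.  Each target of size at least 20n absorbs as
   many orphans as fit before picking its own two elements, so the total of the
   orphans decreases by at least (3/4) a_i as long as any remain.  The last
   large target takes all remaining orphans, and its residue modulo n is then
   automatically 0.  Finally the untouched pairs are distributed. *)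
Require Import Defs.
From mathcomp Require Import all_boot all_order all_algebra.
From mathcomp Require Import zify.

Set Implicit Arguments.
Unset Strict Implicit.
Unset Printing Implicit Defensive.

Import Order.TTheory GRing.Theory Num.Theory.
Local Open Scope ring_scope.

(** * Weights, and pairing by negation modulo m + 1 *)

Definition weight (n : nat) (S : {set 'I_n}) : nat := (\sum_(x in S) (x : nat))%N.

Lemma weightU (n : nat) (A B : {set 'I_n}) :
  [disjoint A & B] -> weight (A :|: B) = (weight A + weight B)%N.
Proof.
move=> dAB; rewrite /weight (eq_bigl (fun x => (x \in A) || (x \in B))).
  exact: bigU.
by move=> x; rewrite inE.
Qed.

Lemma weight0 (n : nat) : weight (set0 : {set 'I_n}) = 0%N.
Proof. exact: big_set0. Qed.

Lemma weightD (n : nat) (A B : {set 'I_n}) :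
  A \subset B -> weight B = (weight A + weight (B :\: A))%N.
Proof.
move=> sAB; rewrite -weightU; last by rewrite -setI_eq0; apply/eqP/setP=> x; rewrite !inE; case: (x \in A).
by congr weight; apply/setP=> x; rewrite !inE; case: (boolP (x \in A)) => // /(subsetP sAB).
Qed.

Lemma weightT (m : nat) : weight [set: 'I_m.+1] = ((m * m.+1) %/ 2)%N.
Proof.
rewrite /weight (eq_bigl xpredT) => [|x]; last by rewrite inE.
rewrite -(big_mkord xpredT (fun i => i)) /= bin2_sum bin2 /= mulnC.
by rewrite divn2.
Qed.

(** With ['I_m.+1] read as the integers modulo n = m + 1, the partner n - x of a nonzero [x] is
    [- x], so pairing becomes ring negation. *)
Lemma val_oppZp (m : nat) (x : 'I_m.+1) : x != 0 -> (- x)%R = (m.+1 - x)%N :> nat.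
Proof.
move=> x0 /=; rewrite modn_small //.
have : (x : nat) != 0%N by [].
by have := ltn_ord x; lia.
Qed.

Lemma addr_val (m : nat) (x : 'I_m.+1) : x != 0 -> ((x : nat) + (- x)%R)%N = m.+1.
Proof. by move=> x0; rewrite val_oppZp //; have := ltn_ord x; lia. Qed.

Lemma weight2 (n : nat) (x y : 'I_n) : x != y -> weight [set x; y] = (x + y)%N.
Proof.
move=> xy; rewrite weightU ?disjoints1 ?inE // /weight.
  by rewrite !big_set1.
Qed.

(** * Partial colorings, where [None] marks an element not yet given to a target *)

Definition block (n t : nat) (g : 'I_n -> option 'I_t) (i : 'I_t) : {set 'I_n} :=
  [set x | g x == Some i].

Definition recolor (n t : nat) (g : 'I_n -> option 'I_t) (i : 'I_t)
    (C : {set 'I_n}) (x : 'I_n) : option 'I_t :=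
  if x \in C then Some i else g x.

Lemma weight_recolor (n t : nat) (g : 'I_n -> option 'I_t) (i j : 'I_t) (C : {set 'I_n}) :
  (forall x, x \in C -> g x = None) ->
  weight (block (recolor g i C) j) = ((if j == i then weight C else 0) + weight (block g j))%N.
Proof.
move=> gC; have [->|ji] := eqVneq j i.
  rewrite -weightU.
    congr weight; apply/setP=> x; rewrite !inE /recolor.
    by case: ifP; rewrite ?eqxx.
  rewrite -setI_eq0; apply/eqP/setP=> x; rewrite !inE.
  by apply/negP => /andP[/gC->].
rewrite add0n; congr weight; apply/setP=> x; rewrite !inE /recolor.
case: ifP => // /gC->.
by rewrite (inj_eq Some_inj) eq_sym (negPf ji).
Qed.

Lemma weight_blocks (n t : nat) (g : 'I_n -> option 'I_t) :
  weight [set x | g x != None] = (\sum_i weight (block g i))%N.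
Proof.
rewrite /weight (exchange_big_dep (fun x => g x != None)) /=; last first.
  by move=> i x _; rewrite inE => /eqP->.
rewrite (eq_bigl (fun x => g x != None)) => [|x]; last by rewrite inE.
apply: eq_bigr => x; case gx: (g x) => [i|] // _.
rewrite (big_pred1 i) // => j.
by rewrite inE gx (inj_eq Some_inj) eq_sym.
Qed.

(** * Sets made of complete pairs *)

(** Each pair [x], [- x] weighs m + 1, so [U] holds exactly as many pairs as are demanded; one pair
    goes to some [i] with [K i] positive, by induction on the total demand. *)
Lemma fill_pairs (m t : nat) (K : 'I_t -> nat) (U : {set 'I_m.+1}) :
  (forall x, x \in U -> - x \in U) -> (forall x, x \in U -> - x != x) ->
  weight U = (m.+1 * \sum_i K i)%N ->
  exists f : 'I_m.+1 -> option 'I_t,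
    (forall x, (f x != None) = (x \in U)) /\
    forall i, weight (block f i) = (m.+1 * K i)%N.
Proof.
move: {2}(\sum_i K i)%N (erefl (\sum_i K i)%N) => k.
elim: k K U => [|k IH] K U Kk symU fixU wU.
  exists (fun=> None); split=> [x|i].
    apply/esym/negP=> Ux; move: wU; rewrite Kk muln0 /weight (big_setD1 x Ux) /=.
    have := fixU _ Ux; have [->|] := eqVneq x 0; first by rewrite oppr0 eqxx.
    by rewrite -val_eqE /=; lia.
  have : (K i <= \sum_i K i)%N by rewrite (bigD1 i) //= leq_addr.
  rewrite Kk leqn0 => /eqP->; rewrite muln0.
  have -> : block (fun=> None : option 'I_t) i = set0 :> {set 'I_m.+1}.
    by apply/setP=> x; rewrite !inE.
  exact: weight0.
have [i Ki] : exists i, (0 < K i)%N.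
  case: (pickP (fun i => 0 < K i)%N) => [i Ki|K0]; first by exists i.
  by move: Kk; rewrite big1 // => i _; have := K0 i; lia.
have [x Ux] : exists x, x \in U.
  by apply/set0Pn/eqP=> U0; move: wU; rewrite U0 weight0 Kk; lia.
have nxx := fixU _ Ux.
have x0 : x != 0 by apply: contraNneq nxx => ->; rewrite oppr0.
pose U' := U :\: [set x; - x].
pose K' j := (K j - (j == i))%N.
have sumK : (\sum_j K j = (\sum_j K' j).+1)%N.
  rewrite (bigD1 i) //= [in RHS](bigD1 i) //= {1}/K' eqxx.
  rewrite (eq_bigr K') => [|j /negPf ji]; last by rewrite /K' ji subn0.
  by lia.
have sP : [set x; - x] \subset U by rewrite subUset !sub1set Ux symU.
have wP : weight [set x; - x] = m.+1 by rewrite weight2 1?eq_sym // addr_val.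
have wU' : weight U = (m.+1 + weight U')%N by rewrite (weightD sP) wP.
have [] := IH K' U'.
- by lia.
- move=> y; rewrite !inE !negb_or => /andP[/andP[yx yNx] Uy].
  by rewrite symU // eqr_opp yx andbT andbT -eqr_opp opprK.
- by move=> y; rewrite inE => /andP[_ /fixU].
- by move: wU; rewrite wU' sumK; lia.
move=> f [fU fK]; exists (recolor f i [set x; - x]); split=> [y|j].
  rewrite /recolor; case: ifP => [/(subsetP sP)->//|yP].
  by rewrite fU inE yP.
rewrite weight_recolor => [|y yP]; last first.
  by apply/eqP; apply: contraTT yP; rewrite fU inE => /andP[].
rewrite fK /K' wP; case: eqP => [->|_]; last by rewrite subn0.
by nia.
Qed.

(** [U] is a disjoint union of pairs of weight m + 1. This later settles the residue of the last
    target. *)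
Lemma weight_sym_dvd (m : nat) (U : {set 'I_m.+1}) :
  (forall x, x \in U -> - x \in U) -> (forall x, x \in U -> - x != x) ->
  (m.+1 %| weight U)%N.
Proof.
move: {2}#|U| (leqnn #|U|) => k; elim: k U => [|k IH] U Uk symU fixU.
  by move: Uk; rewrite leqn0 cards_eq0 => /eqP->; rewrite weight0 dvdn0.
have [->|/set0Pn[x Ux]] := eqVneq U set0; first by rewrite weight0 dvdn0.
have nxx := fixU _ Ux.
have x0 : x != 0 by apply: contraNneq nxx => ->; rewrite oppr0.
have sP : [set x; - x] \subset U by rewrite subUset !sub1set Ux symU.
rewrite (weightD sP) weight2 1?eq_sym // addr_val // dvdn_addr //; apply: IH.
- by have := cardsD U [set x; - x]; rewrite (setIidPr sP) cards2 (eq_sym x) nxx; lia.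
- move=> y; rewrite !inE !negb_or => /andP[/andP[yx yNx] Uy].
  by rewrite symU // eqr_opp yx andbT andbT -eqr_opp opprK.
- by move=> y; rewrite inE => /andP[_ /fixU].
Qed.

(** * Selecting orphans and fresh elements *)

(** Elements are discarded one at a time until the weight first falls to [c] or below; the last one
    discarded is less than [n], which bounds the gap. *)
Lemma subset_weight_le (n : nat) (O : {set 'I_n}) (c : nat) :
  exists2 O' : {set 'I_n}, O' \subset O &
    (weight O' <= c)%N /\ (O' = O \/ (c < weight O' + n)%N).
Proof.
move: {2}#|O| (leqnn #|O|) => k; elim: k O => [|k IH] O Ok.
  move: Ok; rewrite leqn0 cards_eq0 => /eqP->.
  by exists set0; rewrite ?sub0set // weight0; split=> //; left.
have [wO|wO] := leqP (weight O) c; first by exists O => //; split=> //; left.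
have [O0|/set0Pn[x Ox]] := eqVneq O set0; first by move: wO; rewrite O0 weight0.
have [|O' sO' [wO' cO']] := IH (O :\ x); first by have := cardsD1 x O; rewrite Ox; lia.
exists O'; first exact: subset_trans sO' (subD1set _ _).
split=> //; right; case: cO' => // O'E; subst O'.
move: wO; rewrite /weight (big_setD1 x Ox) /=; have := ltn_ord x; lia.
Qed.

Lemma notin_seq (s : seq nat) (k : nat) :
  (size s < k)%N -> exists2 y, (y < k)%N & y \notin s.
Proof.
move=> sk; have : ~~ all (mem s) (iota 0 k).
  apply/negP=> /allP sub.
  by have := uniq_leq_size (iota_uniq 0 k) sub; rewrite size_iota leqNgt sk.
by case/allPn=> y; rewrite mem_iota => /= yk ys; exists y.
Qed.

(** The choice of [y] determines [z] as the residue of b - y, so it suffices to avoid at most 2|V| +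
    4 bad values of [y] among the min(b, n) values available. *)
Lemma fresh_two (m b : nat) (V : {set 'I_m.+1}) :
  (2 * #|V| + 4 < b)%N -> (2 * #|V| + 4 < m.+1)%N ->
  exists y z : 'I_m.+1, [/\ y != 0, z != 0, y != z, y \notin V & z \notin V]
     /\ (y + z <= b)%N /\ (y + z = b %[mod m.+1])%N.
Proof.
move=> Vb Vm.
set n := m.+1 in Vm *; pose r := (b %% n)%N.
pose h v := ((r + n - v) %% n)%N.
have rn : (r < n)%N by rewrite ltn_mod.
pose vs := [seq val v | v <- enum V].
(* Excluded are [y] in [V], [z] in [V] (through the involution [h]), [y] = 0, [z] = 0 (that is, [y]
   = r), and the two candidates for [y] = [z]. *)
have [|y yb] := @notin_seq (vs ++ map h vs ++ [:: 0; r; r./2; (r + n)./2]%N) (minn b n).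
  by rewrite !size_cat size_map /vs size_map -cardE leq_min /= !addnA addnn -mul2n Vb Vm.
rewrite !mem_cat !inE !negb_or => /and5P[yV yhV y0 yr /andP[y1 y2]].
have yn : (y < n)%N by lia.
have hE : h y = if (y <= r)%N then (r - y)%N else (r + n - y)%N.
  rewrite /h; case: ifP => yr'; last by rewrite modn_small //; lia.
  by rewrite addnC -addnBA // modnDl modn_small //; lia.
have hyn : (h y < n)%N by rewrite ltn_mod.
have hhy : h (h y) = y.
  rewrite {1}/h hE; case: ifP => yr'.
    have -> : (r + n - (r - y) = y + n)%N by lia.
    by rewrite modnDr modn_small.
  have -> : (r + n - (r + n - y) = y)%N by lia.
  by rewrite modn_small.
exists (Ordinal yn), (Ordinal hyn).
rewrite -!val_eqE /=.
split; [split|split].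
- by [].
- by rewrite hE; case: ifP; lia.
- by rewrite hE; case: ifP; lia.
- by apply: contra yV => yV; apply/mapP; exists (Ordinal yn); rewrite ?mem_enum.
- apply: contra yhV => hV; rewrite -hhy; apply: map_f.
  by apply/mapP; exists (Ordinal hyn); rewrite ?mem_enum.
(* The sum is r or r + n. The latter needs y > r; since y < b, this rules out b < n, where r = b. *)
- rewrite hE; have := divn_eq b n; rewrite -/r => bE.
  case: ifP => yr'; first by rewrite subnKC // leq_mod.
  rewrite subnKC ?[leqRHS]bE ?(addnC r) ?leq_add2r ?leq_pmull //; last by lia.
  rewrite divn_gt0 //; move: yb yr'; rewrite /r; have [//|bn] := leqP n b.
  by rewrite modn_small //; lia.
- rewrite hE -(modn_mod b) -/r; case: ifP => yr'; first by congr modn; lia.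
  have -> : (y + (r + n - y) = r + n)%N by lia.
  by rewrite modnDr.
Qed.

(** * The invariant, and the service of one target *)

(* Once the targets in [s] have been served, [g] colors the elements given to
   them, [V] is the set of all touched elements, closed under [x |-> -x], and
   [O] is the set of touched elements not given to anybody yet. *)
Record state (m t : nat) (a : 'I_t -> nat) (s : {set 'I_t})
    (g : 'I_m.+1 -> option 'I_t) (O V : {set 'I_m.+1}) : Prop := State {
  state_fix : forall x, - x = x -> x \in V;
  state_opp : forall x, x \in V -> - x \in V;
  state_sub : O \subset V;
  state_0 : 0 \notin O;
  state_dom : forall x, (g x != None) = [&& x \in V, x \notin O & x != 0];
  state_img : forall x i, g x = Some i -> i \in s;
  state_le : forall i, i \in s -> (weight (block g i) <= a i)%N;
  state_mod : forall i, i \in s -> (weight (block g i) = a i %[mod m.+1])%N;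
  state_card : (#|V| <= 4 * #|s| + 2)%N }.

Lemma opp_fixed_half (m : nat) (x : 'I_m.+1) : - x = x -> x != 0 -> x = (m.+1)./2 :> nat.
Proof.
by move=> xx x0; have := addr_val x0; rewrite xx; lia.
Qed.

(** [V] starts as the fixed points of negation: 0 and, for odd [m], the midpoint (m + 1)/2, which
    has no partner and is an orphan from the start. These account for the 2 in [state_card]. *)
Lemma state_init (m t : nat) (a : 'I_t -> nat) :
  exists O V : {set 'I_m.+1}, state a set0 (fun=> None) O V /\ (weight O <= m.+1)%N.
Proof.
pose V := [set x : 'I_m.+1 | - x == x].
have sO : V :\ 0 \subset [set inord (m.+1)./2].
  apply/subsetP=> x; rewrite !inE => /andP[x0 /eqP xx].
  by rewrite -(opp_fixed_half xx x0) inord_val.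
exists (V :\ 0), V; split.
  split=> //.
  - by move=> x xx; rewrite inE; apply/eqP.
  - by move=> x; rewrite !inE opprK eq_sym.
  - exact: subD1set.
  - by rewrite !inE eqxx.
  - by move=> x; rewrite !inE; case: (- x == x); case: (x == 0).
  - by move=> i; rewrite inE.
  - by move=> i; rewrite inE.
  - have := subset_leq_card sO; rewrite cards1.
    rewrite (cardsD1 0 V) cards0; by move: #|V :\ 0| => k; case: (0 \in V) => /=; lia.
have := weightD sO; rewrite /weight big_set1.
by have := ltn_ord (@inord m (m.+1)./2); lia.
Qed.

(** [P] goes to the target and corrects its residue; [Q] holds the partners, which become
    orphans. *)
Lemma correcting_set (m b : nat) (V : {set 'I_m.+1}) :
  (forall x, - x = x -> x \in V) -> (forall x, x \in V -> - x \in V) ->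
  (2 * #|V| + 4 < b)%N -> (2 * #|V| + 4 < m.+1)%N ->
  exists P Q : {set 'I_m.+1},
    [/\ [disjoint P & Q], forall x, x \in P :|: Q -> x \notin V,
        forall x, x \in P :|: Q -> - x \in P :|: Q & (#|P :|: Q| <= 4)%N] /\
    [/\ (weight P <= b)%N, (weight P = b %[mod m.+1])%N & (weight Q <= 2 * m.+1)%N].
Proof.
(* If m + 1 divides [b], nothing needs correcting. Otherwise it does not divide y + z, so [y] and
   [z] are not partners of each other. *)
move=> fixV oppV Vb Vm; have [mb|nmb] := boolP (m.+1 %| b)%N.
  exists set0, set0; split; split; rewrite ?weight0 ?setU0 ?cards0 //.
  - by rewrite -setI_eq0 setI0.
  - by move=> x; rewrite inE.
  - by move=> x; rewrite inE.
  - by rewrite mod0n; apply/esym/eqP.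
have [y [z [[y0 z0 yz yV zV] [yzb yzmod]]]] := fresh_two Vb Vm.
have nV x : x \notin V -> - x \notin V.
  by apply: contra => /oppV; rewrite opprK.
have nfix x : x \notin V -> x != - x.
  by apply: contraNneq => xx; apply: fixV.
have yNz : y != - z.
  apply: contra nmb => /eqP yE; rewrite /dvdn -yzmod yE addnC addr_val //.
  by rewrite modnn.
have zNy : z != - y by rewrite -eqr_opp opprK eq_sym.
exists [set y; z], [set - y; - z]; split; split.
- rewrite -setI_eq0; apply/eqP/setP=> x; rewrite !inE.
  apply/negP=> /andP[/orP[]/eqP-> /orP[]]; apply/negP => //; exact: nfix.
- by move=> x; rewrite !inE => /orP[]/orP[]/eqP->; rewrite ?nV.
- by move=> x; rewrite !inE => /orP[]/orP[]/eqP->; rewrite ?opprK !eqxx ?orbT.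
- by rewrite cardsU !cards2; case: (_ != _); case: (_ != _); lia.
- by rewrite weight2.
- by rewrite weight2.
- rewrite weight2 ?eqr_opp //.
  by have := ltn_ord (- y); have := ltn_ord (- z); lia.
Qed.

(** Target [i] receives [O'] and a set [P] correcting the residue of the remainder; the partners [Q]
    join the orphans and add at most 2(m + 1). *)
Lemma state_step (m t : nat) (a : 'I_t -> nat) (s : {set 'I_t})
    (g : 'I_m.+1 -> option 'I_t)
    (O V O' : {set 'I_m.+1}) (i : 'I_t) :
  state a s g O V -> i \notin s -> O' \subset O ->
  (2 * #|V| + 4 < a i - weight O')%N -> (2 * #|V| + 4 < m.+1)%N ->
  exists g' (O2 V2 : {set 'I_m.+1}), state a (i |: s) g' O2 V2 /\
    (weight O2 + weight O' <= weight O + 2 * m.+1)%N.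
Proof.
case=> fixV oppV sOV O0 dom img le_a mod_a cardV si sO' Vb Vm.
have [P [Q [[dPQ nV oppPQ cPQ] [wPb wPmod wQ]]]] := correcting_set fixV oppV Vb Vm.
have zV : 0 \in V by apply: fixV; rewrite oppr0.
have nP x : x \in P -> x \notin V by move=> Px; apply: nV; rewrite inE Px.
have nQ x : x \in Q -> x \notin V by move=> Qx; apply: nV; rewrite inE Qx orbT.
have dPO' : [disjoint P & O'].
  rewrite -setI_eq0; apply/eqP/setP=> x; rewrite !inE; apply/negP=> /andP[/nP + O'x].
  by rewrite (subsetP sOV) // (subsetP sO').
have gC x : x \in P :|: O' -> g x = None.
  rewrite inE => xC; apply/eqP; rewrite -[_ == _]negbK dom.
  case/orP: xC => [/nP/negPf->//|/(subsetP sO')->].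
  by rewrite andbF.
have gi : weight (block g i) = 0%N.
  suff -> : block g i = set0 by rewrite weight0.
  apply/setP=> x; rewrite !inE; apply/negP=> /eqP /img.
  by apply/negP.
exists (recolor g i (P :|: O')), (O :\: O' :|: Q), (V :|: (P :|: Q)); split; last first.
  apply: (@leq_trans (weight (O :\: O') + weight Q + weight O')).
    rewrite leq_add2r -weightU // -setI_eq0; apply/eqP/setP=> x; rewrite !inE.
    by apply/negP=> /andP[/andP[_ Ox] /nQ]; rewrite (subsetP sOV).
  by rewrite (weightD sO'); lia.
have wC j := weight_recolor i j gC.
split.
- by move=> x xx; rewrite inE fixV.
- by move=> x; rewrite inE => /orP[/oppV Vx|/oppPQ xPQ]; rewrite inE ?Vx ?xPQ ?orbT.
- rewrite subUset; apply/andP; split.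
    by apply: subset_trans (subsetUl _ _); apply: subset_trans sOV; apply: subsetDl.
  by rewrite setUA subsetUr.
- rewrite !inE negb_or (negPf O0) andbF /=.
  by apply/negP=> /nQ; rewrite zV.
- move=> x; rewrite /recolor !inE.
  have [Px|nPx] /= := boolP (x \in P).
    have nVx := nP _ Px.
    have nQx : x \notin Q by move/disjointFr: dPQ => ->.
    rewrite (negPf nVx) (negPf nQx) orbF /= negb_and negbK.
    rewrite [x \in O](contraNF (subsetP sOV x)) ?orbT //=.
    by rewrite (contraNneq _ nVx) // => ->.
  have [O'x|nO'x] /= := boolP (x \in O').
    have Ox := subsetP sO' _ O'x.
    rewrite (subsetP sOV _ Ox) /=.
    have -> : x \in Q = false by apply: contraTF (subsetP sOV _ Ox) => /nQ.
    by apply/esym; apply: contraNneq O0 => <-.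
  rewrite dom.
  have [Qx|nQx] /= := boolP (x \in Q); last by rewrite !orbF.
  by rewrite (negPf (nQ _ Qx)) ?orbT /= ?andbF.
- move=> x j; rewrite /recolor !inE; case: ifP => [_ [<-]|_ /img->]; first by rewrite eqxx.
  by rewrite orbT.
(* The truncated difference [a i - weight O'] is positive by hypothesis, hence exact. *)
- move=> j; rewrite wC !inE weightU //; have [->|ji] /= := eqVneq j i; last first.
    exact: le_a.
  by rewrite gi; lia.
- move=> j; rewrite wC !inE weightU //; have [->|ji] /= := eqVneq j i; last first.
    exact: mod_a.
  move=> _; rewrite gi addn0 -modnDml wPmod modnDml; congr (_ %% _)%N; lia.
- rewrite cardsU1 si cardsU; lia.
Qed.

(** * The small targets, then the large ones *)

Lemma state_card_le (m t : nat) (a : 'I_t -> nat) (s : {set 'I_t})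
    (g : 'I_m.+1 -> option 'I_t) (O V : {set 'I_m.+1}) (k : nat) :
  state a s g O V -> (#|s| <= k)%N -> (2 * #|V| + 4 <= 8 * k.+1)%N.
Proof.
by move=> /state_card; move: #|s| #|V| => p q; lia.
Qed.

Lemma card_ord_lt (t k : nat) : (#|[set i : 'I_t | (i < k)%N]| <= k)%N.
Proof.
rewrite cardE -(size_map val) -[leqRHS](size_iota 0); apply: uniq_leq_size.
  by rewrite (map_inj_uniq val_inj) enum_uniq.
by move=> j /mapP[i]; rewrite mem_enum inE mem_iota => ? ->.
Qed.

(** When index [k] is reached, at most [k] targets have been served, so at most 8(k + 1) values are
    forbidden, well below 1600(k + 1). Nothing is absorbed: each target adds at most 2(m + 1) to the
    orphans. *)
Lemma small_phase (m t : nat) (a : 'I_t -> nat) (k : nat) :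
  (forall i, (a i < 20 * m.+1)%N -> (1600 * i.+1 <= a i)%N) ->
  let s := [set i | (a i < 20 * m.+1)%N && (i < k)%N] in
  exists g (O V : {set 'I_m.+1}), state a s g O V /\
    (weight O <= 2 * m.+1 * #|s| + m.+1)%N.
Proof.
move=> a_ge; elim: k => [|k IH] s.
  have [O [V [st wO]]] := state_init m a; exists (fun=> None), O, V.
  have -> : s = set0 by apply/setP=> i; rewrite !inE andbF.
  by rewrite cards0 muln0.
case: IH; set s' := [set i | _] => g [O [V [st wO]]].
have [[i ik ai]|nk] : (exists2 i : 'I_t, i = k :> nat & (a i < 20 * m.+1)%N) \/
    forall i : 'I_t, i = k :> nat -> ~~ (a i < 20 * m.+1)%N.
  case: (pickP (fun i : 'I_t => (i == k :> nat) && (a i < 20 * m.+1)%N)) => [i /andP[/eqP]|nk].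
    by left; exists i.
  by right=> i ik; have := nk i; rewrite ik eqxx /= => ->.
- have sE : s = i |: s'.
    apply/setP=> j; rewrite !inE (ltnS j) (leq_eqVlt j) -val_eqE /= ik.
    case: eqP => [jk|//]; have -> : j = i by apply: val_inj; rewrite /= jk.
    by rewrite ai.
  have is' : i \notin s' by rewrite inE ik ltnn andbF.
  have cs' : (#|s'| <= k)%N.
    apply: leq_trans (card_ord_lt t k); apply: subset_leq_card.
    by apply/subsetP=> j; rewrite !inE => /andP[].
  have ai' := a_ge i ai; have cV := state_card_le st cs'.
  have [||g' [O' [V' [st' wO']]]] := state_step st is' (sub0set O).
  + by rewrite weight0 subn0; apply: leq_ltn_trans cV _; lia.
  (* Here 1600(k + 1) <= a_k < 20(m + 1) gives 80(k + 1) < m + 1. *)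
  + by apply: leq_ltn_trans cV _; lia.
  exists g', O', V'; rewrite sE; split=> //.
  by rewrite cardsU1 is'; move: #|s'| wO wO' => p; rewrite weight0; nia.
have -> : s = s'.
  apply/setP=> j; rewrite !inE (ltnS j) (leq_eqVlt j); case: eqP => [jk|//].
  by rewrite (negPf (nk _ jk)).
by exists g, O, V.
Qed.

(** Either the last target served absorbs all orphans and only its own at most 2(m + 1) remain, or
    every target has reduced them by 3/4 of its size. The head of [l] is served after its tail. *)
Lemma large_phase (m t : nat) (a : 'I_t -> nat) (s : {set 'I_t})
    (g : 'I_m.+1 -> option 'I_t) (O V : {set 'I_m.+1}) (l : seq 'I_t) :
  state a s g O V -> uniq l ->
  (forall i, i \in l -> i \notin s) ->
  (forall i, i \in l -> (20 * m.+1 <= a i)%N) ->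
  (8 * (#|s| + size l) < m.+1)%N ->
  exists g' (O' V' : {set 'I_m.+1}), state a (s :|: [set i in l]) g' O' V' /\
    ((weight O' <= 2 * m.+1)%N \/
     (4 * weight O' + 3 * \sum_(i <- l) a i <= 4 * weight O)%N).
Proof.
move=> st; elim: l => [|i l IH] /=.
  move=> _ _ _ _; exists g, O, V; split.
    suff -> : s :|: [set i in [::]] = s by [].
    by apply/setP=> i; rewrite !inE orbF.
  by right; rewrite big_nil muln0 addn0.
move=> /andP[il ul] ls la szl.
have [//|j jl|j jl||g' [O' [V' [st' wO']]]] := IH.
- by apply: ls; rewrite inE jl orbT.
- by apply: la; rewrite inE jl orbT.
- by apply: leq_ltn_trans szl; rewrite leq_mul2l leq_add2l leqnSn.
have ai : (20 * m.+1 <= a i)%N by apply: la; rewrite inE eqxx.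
have is' : i \notin s :|: [set i in l].
  by rewrite !inE negb_or il ls // inE eqxx.
have cs : (#|s :|: [set i in l]| <= #|s| + size l)%N.
  apply: leq_trans (leq_card_setU _ _) _; rewrite leq_add2l cardsE.
  exact: card_size.
have cV := state_card_le st' cs.
(* The reserve 2(m + 1) keeps the remaining demand above the number of forbidden values. *)
have [R sR [wR cR]] := subset_weight_le O' (a i - 2 * m.+1).
have [||g2 [O2 [V2 [st2 wO2]]]] := state_step st' is' sR.
- by apply: leq_ltn_trans cV _; move: #|s| szl => p; lia.
- by apply: leq_ltn_trans cV _; move: #|s| szl => p; lia.
exists g2, O2, V2; split.
  suff -> : s :|: [set j in i :: l] = i |: (s :|: [set j in l]) by [].
  by apply/setP=> j; rewrite !inE orbCA.
have wRO : (weight R <= weight O')%N by rewrite (weightD sR) leq_addr.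
rewrite big_cons; case: cR => [RO|cR]; first by left; rewrite RO in wO2; lia.
(* Now [R] weighs more than a_i - 3(m + 1), so the orphans lose more than a_i - 5(m + 1) >=
   (3/4)a_i, as a_i >= 20(m + 1). The case [weight O'] <= 2(m + 1) contradicts the size of [R]. *)
by right; case: wO'; lia.
Qed.

(** * Completing the coloring *)

Lemma prescribed_coloring (m t : nat) (a : 'I_t -> nat) :
  (0 < m)%N -> (\sum_i a i = (m * m.+1) %/ 2)%N ->
  (forall i, (a i < 20 * m.+1)%N -> (1600 * i.+1 <= a i)%N) ->
  exists h : 'I_m.+1 -> 'I_t,
    forall i, weight [set x | (x != 0) && (h x == i)] = a i.
Proof.
move=> m0 sum_a a_ge.
pose S := [set i | (a i < 20 * m.+1)%N].
have mm : (2 * \sum_i a i = m * m.+1)%N.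
  rewrite sum_a; have : ~~ odd (m * m.+1) by rewrite oddM /= andbN.
  by lia.
have split_sum : (\sum_i a i = \sum_(i in S) a i + \sum_(i in ~: S) a i)%N.
  rewrite (bigID (mem S)) /=; congr (_ + _)%N.
  by apply: eq_bigl => i; rewrite !inE.
(* A small target has 1600(i + 1) < 20(m + 1), so its index is below (m + 1)/80. *)
have cS : (80 * #|S| <= m.+1)%N.
  have : (#|S| <= m.+1 %/ 80)%N.
    apply: leq_trans (card_ord_lt t _); apply: subset_leq_card.
    by apply/subsetP=> i; rewrite !inE => ai; have := a_ge i ai; lia.
  by move: #|S| => k; lia.
have sumS : (\sum_(i in S) a i <= #|S| * (20 * m.+1))%N.
  by rewrite -sum_nat_const leq_sum // => i; rewrite inE => /ltnW.
have sumL : (#|~: S| * (20 * m.+1) <= \sum_(i in ~: S) a i)%N.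
  by rewrite -sum_nat_const leq_sum // => i; rewrite !inE -leqNgt.
have [i0 _] : exists i : 'I_t, true.
  case: (pickP (@predT 'I_t)) => [i _|no]; first by exists i.
  by move: mm; rewrite big_pred0 //; nia.
have m40 : (40 <= m)%N.
  have : (a i0 <= \sum_i a i)%N by rewrite (bigD1 i0) //= leq_addr.
  have := a_ge i0; nia.
have [c ES] : {c | c = #|S|} by exists #|S|.
have [cL EL] : {c | c = #|~: S|} by exists #|~: S|.
rewrite -ES in cS sumS; rewrite -EL in sumL.
(* The small targets total at most (m + 1)^2/4. *)
have sumL_ge : (2 * m * m.+1 <= 4 * \sum_(i in ~: S) a i + m.+1 * m.+1)%N by nia.
have cL40 : (40 * cL <= m)%N by nia.
have [last Llast] : exists i, i \in ~: S.
  by apply/set0Pn/eqP=> L0; move: sumL_ge; rewrite L0 big_set0; nia.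
have alast : (20 * m.+1 <= a last)%N by move: Llast; rewrite !inE -leqNgt.
have [g0 [O0 [V0 [st0 wO0]]]] := small_phase t a_ge.
have SE : [set i | (a i < 20 * m.+1)%N && (i < t)%N] = S.
  by apply/setP=> i; rewrite !inE ltn_ord andbT.
rewrite SE -?ES in st0 wO0.
pose l := enum (~: S :\ last).
have szl : (cL = (size l).+1)%N.
  by rewrite EL (cardsD1 last) Llast -cardE.
have [|i|i||g1 [O [V [st wO]]]] := large_phase st0 (l := l).
- exact: enum_uniq.
- by rewrite mem_enum !inE => /andP[].
- by rewrite mem_enum !inE -leqNgt => /andP[].
- rewrite -ES; move: (size l) szl cL40 cS => k; clear; lia.
have sl : S :|: [set i in l] = [set~ last].
  apply/setP=> i; rewrite !inE mem_enum !inE.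
  have [->|] //= := eqVneq i last; last by rewrite orbN.
  by move: Llast; rewrite !inE orbF => /negPf.
rewrite sl in st.
(* Otherwise three times the large total, at least 3(m + 1)(m - 1)/4, would be below 4 [weight O0],
   at most (m + 1)^2/10 + 4(m + 1); this fails for m >= 40. *)
have wlast : (weight O <= a last)%N.
  case: wO => [|wO]; first by lia.
  have : (\sum_(i in ~: S) a i = a last + \sum_(i <- l) a i)%N.
    by rewrite (big_setD1 last) //= big_enum.
  move: (weight O) (weight O0) (\sum_(i <- l) a i)%N (\sum_(i in ~: S) a i)%N
    (a last) m40 sumL_ge wO wO0 cS => w w0 X Y y; clear => m40 sumL_ge wO wO0 cS YE.
  have h1 : (m.+1 * (80 * c) <= m.+1 * m.+1)%N by rewrite leq_mul2l cS orbT.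
  have h2 : (40 * m.+1 <= m * m.+1)%N by rewrite leq_mul2r m40 orbT.
  have h3 : (m.+1 * m.+1 = m * m.+1 + m.+1)%N by rewrite mulSn addnC.
  lia.
case: st => fixV oppV sOV O0' dom img le_a mod_a _.
have zV : 0 \in V by apply: fixV; rewrite oppr0.
have gO x : x \in O -> g1 x = None.
  by move=> xO; apply/eqP; rewrite -[_ == _]negbK dom xO andbF.
have glast : weight (block g1 last) = 0%N.
  suff -> : block g1 last = set0 by rewrite weight0.
  by apply/setP=> x; rewrite !inE; apply/negP=> /eqP /img; rewrite !inE eqxx.
pose g := recolor g1 last O.
have wg i : weight (block g i) = if i == last then weight O else weight (block g1 i).
  by rewrite weight_recolor //; case: eqP => [->|]; rewrite ?glast ?addn0.
have gdom x : (g x != None) = (x \in V) && (x != 0).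
  rewrite /g /recolor; case: ifP => xO; last by rewrite dom xO.
  by rewrite (subsetP sOV _ xO); apply/esym; apply: contraNneq O0' => <-.
have symU x : x \in ~: V -> - x \in ~: V.
  by rewrite !inE; apply: contra => /oppV; rewrite opprK.
have fixU x : x \in ~: V -> - x != x.
  by rewrite inE; apply: contraNneq => /fixV.
(* [g] colors all of [V] except 0, which weighs nothing. *)
have total : (\sum_i a i = weight (~: V) + \sum_i weight (block g i))%N.
  rewrite sum_a -weightT (weightD (subsetT (~: V))) setTD setCK; congr (_ + _)%N.
  rewrite -weight_blocks (weightD (B := V) (A := [set x | g x != None])); last first.
    by apply/subsetP=> x; rewrite inE gdom => /andP[].
  rewrite [X in (_ + X)%N](_ : _ = 0)%N ?addn0 // /weight big1 // => x.
  by rewrite !inE gdom; case: (x \in V); rewrite ?andbF //= andbT negbK => /eqP->.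
have le_g i : (weight (block g i) <= a i)%N.
  rewrite wg; case: eqP => [->//|/eqP il]; apply: le_a.
  by rewrite !inE.
have sumD : (\sum_i (a i - weight (block g i)) = weight (~: V))%N.
  by rewrite sumnB // total addnK.
have dvd_ne i : i != last -> (m.+1 %| a i - weight (block g i))%N.
  move=> il; rewrite -eqn_mod_dvd // wg (negPf il); apply/eqP/esym/mod_a.
  by rewrite !inE.
have dvd_g i : (m.+1 %| a i - weight (block g i))%N.
  have [->|/dvd_ne//] := eqVneq i last.
  (* The demands sum to the weight of the untouched pairs, a multiple of m + 1, and all but the last
     are multiples too. *)
  have := weight_sym_dvd symU fixU; rewrite -sumD (bigD1 last) //= dvdn_addl //.
  exact: dvdn_sum.
pose K i := ((a i - weight (block g i)) %/ m.+1)%N.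
have KE i : (m.+1 * K i = a i - weight (block g i))%N by rewrite mulnC divnK.
have [|f [fU fK]] := fill_pairs (K := K) symU fixU.
  by rewrite big_distrr /= (eq_bigr _ (fun i _ => KE i)).
(* The default [last] is reached only at 0, which the color classes leave out. *)
exists (fun x => odflt last (if g x is Some i then Some i else f x)) => i.
have -> : [set x | (x != 0) && (odflt last (if g x is Some i then Some i else f x) == i)]
    = block g i :|: block f i.
  apply/setP=> x; rewrite !inE; have := gdom x; have := fU x; rewrite inE.
  have [->|x0] := eqVneq x 0.
    by rewrite zV /=; case: (g 0) => //; case: (f 0).
  by case: (x \in V) => /=; case: (g x) => [j|] //=; case: (f x) => [k|] //= _ _;
    rewrite ?(inj_eq Some_inj) ?orbF.
rewrite weightU.
  by rewrite fK KE subnKC.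
rewrite -setI_eq0; apply/eqP/setP=> x; rewrite !inE; apply/negP=> /andP[/eqP gx /eqP fx].
by have := gdom x; have := fU x; rewrite inE gx fx; case: (x \in V).
Qed.

(** * From the coloring to the partition *)

Theorem theorem1p3 (m t : nat) (a : 'I_t -> int)
    (m_gt0 : (0 < m)%N)
    (sum_a : \sum_(i < t) a i = ((m * m.+1) %/ 2)%N%:Z)
    (a_ge : forall i : 'I_t,
       Num.min (1600 * i.+1%:Z) (20 * m.+1%:Z) <= a i) :
  exists A : 'I_t -> {set 'I_m.+1},
    partitioned_into A (one_to m) /\
    forall i : 'I_t, \sum_(x in A i) (x : nat)%:Z = a i.
Proof.
have a_gt0 i : 0 < a i by have := a_ge i; lia.
have absK i : (`|a i|%N : int) = a i by rewrite gez0_abs // ltW.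
have [||h hw] := @prescribed_coloring m t (fun i => `|a i|%N) m_gt0.
- apply/eqP; rewrite -eqz_nat -sum_a (big_morph Posz PoszD (erefl 0%:Z)).
  by apply/eqP/eq_bigr => i _; rewrite absK.
- by move=> i; have := a_ge i; have := absK i; lia.
pose A i := [set x : 'I_m.+1 | (x != 0) && (h x == i)].
(* Positive targets make the classes nonempty, which yields both injectivity of [A] and the absence
   of an empty block. *)
have An0 i : A i != set0.
  apply/eqP=> A0; have := hw i; rewrite -/(A i) A0 weight0 => a0.
  by have := a_gt0 i; rewrite -absK -a0.
exists A; split; [split|] => [i j Aij||i].
- have /set0Pn[x Ax] := An0 i; have := Ax; rewrite Aij.
  by move: Ax; rewrite !inE => /andP[_ /eqP <-] /andP[_ /eqP].
- apply/and3P; split.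
  + apply/eqP/setP=> x; rewrite inE lt0n; apply/bigcupP/idP => [[B /imsetP[i _ ->]]|x0].
      by rewrite inE => /andP[].
    by exists (A (h x)); rewrite ?imset_f // inE eqxx andbT.
  + apply/trivIsetP=> _ _ /imsetP[i _ ->] /imsetP[j _ ->] nij.
    rewrite -setI_eq0; apply: contraR nij => /set0Pn[x].
    by rewrite !inE => /andP[/andP[_ /eqP <-] /andP[_ /eqP <-]].
  + by apply/imsetP=> -[i _ /esym/eqP]; rewrite (negPf (An0 i)).
- by rewrite -absK -hw (big_morph Posz PoszD (erefl 0%:Z)).
Qed.
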